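(* Let $(W,B)$ be a spherical latin bitrade and $\mathcal{M}^*$ the matrix defined in the context. Then $|\det(\mathcal{M}^* )|={\rm per}(\mathcal{M}^* )$.
   Context: A latin bitrade is a pair $(W,B)$ of non-empty finite sets of triples (row, column, symbol), any two distinct triples in the same set agreeing in at most one coordinate, such that for each $(r,c,s)\in W$ (resp. $B$) there exist unique $r'\ne r$, $c'\ne c$, $s'\ne s$ with $(r',c,s),(r,c',s),(r,c,s')\in B$ (resp. $W$). It is connected if it is not the union of two latin bitrades $(W',B')$, $(W'',B'')$ with $W'\cap W''=\emptyset$. With $R,C,S$ the pairwise disjoint sets of rows, columns, symbols used: for each row $r$ let $\psi_r(s)=s'$ iff $(r,c,s)\in W$, $(r,c,s')\in B$ for some $c$, with analogous permutations for columns and symbols; the bitrade is separated if all are single cycles. It is spherical if separated, connected and $2+|W|-|R|-|C|-|S|=0$. Let $|W|=n+1$ and $\mathcal{V}=R\cup C\cup S$. Let $\mathcal{M}$ be the $(0,1)$-matrix with rows indexed by $\mathcal{V}$ and columns by $W$, where the column of $(r,c,s)$ has 1's exactly in rows $r,c,s$. Fix $(r_0,c_0,s_0)\in W$; $\mathcal{M}^*$ is the $n\times n$ matrix obtained from $\mathcal{M}$ by deleting the column of $(r_0,c_0,s_0)$ and the rows $r_0,c_0,s_0$ (in any ordering of rows and columns). *)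

(* Defs.v *)
From mathcomp Require Import all_boot all_order all_fingroup all_algebra.

Set Implicit Arguments.
Unset Strict Implicit.
Unset Printing Implicit Defensive.

Section LatinBitrades.

(* Ambient finite types of rows, columns and symbols; a bitrade need not use
   all of their elements.  Being distinct types (joined by a sum type below),
   they provide the disjointness of the three label sets. *)
Variables RT CT ST : finType.

Local Notation triple := (RT * CT * ST)%type.
Local Notation vertex := (RT + CT + ST)%type.

Implicit Types W B T : {set triple}.

Definition agreements (t u : triple) : nat :=
  (t.1.1 == u.1.1) + (t.1.2 == u.1.2) + (t.2 == u.2).

Definition partial_latin T : Prop :=
  forall t u, t \in T -> u \in T -> t != u -> agreements t u <= 1.

Definition has_mates T1 T2 : Prop :=
  forall r c s, (r, c, s) \in T1 ->
    [/\ exists! r', r' != r /\ (r', c, s) \in T2,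
        exists! c', c' != c /\ (r, c', s) \in T2
      & exists! s', s' != s /\ (r, c, s') \in T2].

Definition latin_bitrade W B : Prop :=
  [/\ W != set0 /\ B != set0,
      partial_latin W /\ partial_latin B,
      has_mates W B
    & has_mates B W].

Definition connected W B : Prop :=
  ~ exists W' B' W'' B'' : {set triple},
      [/\ latin_bitrade W' B', latin_bitrade W'' B'',
          W = W' :|: W'', B = B' :|: B'' & W' :&: W'' = set0].

(* In a bitrade, W and B use the same rows, columns and symbols. *)
Definition rows W : {set RT} := [set t.1.1 | t in W].
Definition cols W : {set CT} := [set t.1.2 | t in W].
Definition syms W : {set ST} := [set t.2 | t in W].

(* Graphs of the permutations psi_r, psi_c, psi_s; the roles of the three
   coordinates are permuted cyclically. *)
Definition psi_row W B (r : RT) : rel ST :=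
  fun s s' => [exists c, ((r, c, s) \in W) && ((r, c, s') \in B)].
Definition psi_col W B (c : CT) : rel RT :=
  fun r r' => [exists s, ((r, c, s) \in W) && ((r', c, s) \in B)].
Definition psi_sym W B (s : ST) : rel CT :=
  fun c c' => [exists r, ((r, c, s) \in W) && ((r, c', s) \in B)].

(* e is the graph of a permutation of D that consists of a single cycle; that
   permutation is represented by its extension p by the identity outside D. *)
Definition single_cycle (X : finType) (D : {set X}) (e : rel X) : Prop :=
  exists p : {perm X},
    [/\ perm_on D p,
        forall x y, x \in D -> (p x == y) = e x y
      & forall x, x \in D -> porbit p x = D].

Definition separated W B : Prop :=
  [/\ forall r, r \in rows W ->
        single_cycle [set s | [exists c, (r, c, s) \in W]] (psi_row W B r),
      forall c, c \in cols W ->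
        single_cycle [set r | [exists s, (r, c, s) \in W]] (psi_col W B c)
    & forall s, s \in syms W ->
        single_cycle [set c | [exists r, (r, c, s) \in W]] (psi_sym W B s)].

Definition spherical W B : Prop :=
  [/\ latin_bitrade W B, separated W B, connected W B
    & (2 + #|W|%:Z - #|rows W|%:Z - #|cols W|%:Z - #|syms W|%:Z = 0)%R].

Definition row_vertex (r : RT) : vertex := inl (inl r).
Definition col_vertex (c : CT) : vertex := inl (inr c).
Definition sym_vertex (s : ST) : vertex := inr s.

Definition vertices_of (t : triple) : {set vertex} :=
  [set row_vertex t.1.1; col_vertex t.1.2; sym_vertex t.2].

Definition vertices W : {set vertex} :=
  (row_vertex @: rows W) :|: (col_vertex @: cols W) :|: (sym_vertex @: syms W).

Definition incidence (v : vertex) (t : triple) : int := (v \in vertices_of t)%:R%R.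

(* The matrix with rows and columns listed in the orders rho and kappa. *)
Definition reduced_matrix n (rho : 'I_n -> vertex) (kappa : 'I_n -> triple)
    : 'M[int]_n :=
  (\matrix_(i < n, j < n) incidence (rho i) (kappa j))%R.

End LatinBitrades.

Definition ordering_of n (X : finType) (f : 'I_n -> X) (A : {set X}) : Prop :=
  injective f /\ [set f i | i in 'I_n] = A.

Definition permanent (R : comPzRingType) n (A : 'M[R]_n) : R :=
  (\sum_(s : 'S_n) \prod_(i < n) A i (s i))%R.

(* Main.v *)
Require Import Defs.
From mathcomp Require Import all_boot all_order all_fingroup all_algebra.

(* View W and B as the white and black triangles of a triangulated sphere whose
   vertices are the rows, columns and symbols.  A nonzero term of the permanent
   is a matching of the triangles of W :\ t0 with the vertices outside t0, so
   all matchings must be shown to have the same sign.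

   Each t in W is an edge joining its column to its symbol, and dually an arc
   from its row to the row [opp t] of the triple of B across that edge.  The
   signed incidence vectors of the columns and symbols are orthogonal to those
   of the rows, and together they form an invertible matrix Y ([signed_mx]).
   For a matching s, replace each row vector of Y by the unit vector at the
   triangle matched to that row, and call the result X.  Then X Y^T is block
   triangular, with one block independent of s and the other equal to 1 - Q,
   where Q is the matrix of the map sending a row to [opp] of its triangle.
   That map is acyclic, so det (1 - Q) = 1 and det X does not depend on s.
   Finally s is the only matching contributing to det X, so det X is the sign
   of s up to a factor common to all matchings. *)

Set Implicit Arguments.
Unset Strict Implicit.
Unset Printing Implicit Defensive.

Import Order.TTheory GRing.Theory Num.Theory.
Local Open Scope ring_scope.

(** * Kernels and block triangular determinants *)

Section LinearAlgebra.

Lemma exists_linear_relation (F : fieldType) (I J : finType) (A : {set I})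
    (E : {set J}) (M : I -> J -> F) :
  (#|E| < #|A|)%N ->
  exists2 x : I -> F, exists i, x i != 0 &
    (forall i, i \notin A -> x i = 0) /\
    (forall j, j \in E -> \sum_i x i * M i j = 0).
Proof.
move=> ltEA.
pose N : 'M[F]_(#|A|, #|E|) := \matrix_(i, j) M (enum_val i) (enum_val j).
have : kermx N != 0.
  rewrite kermx_eq0 /row_free neq_ltn (leq_ltn_trans _ ltEA) //.
  exact: rank_leq_col.
case/rowV0Pn=> u /sub_kermxP uN0 u_neq0.
have /rV0Pn[k uk] := u_neq0.
pose x i := \sum_(k < #|A|) u 0 k * (enum_val k == i)%:R.
exists x.
  exists (enum_val k); rewrite /x (bigD1 k) //= eqxx mulr1 big1 ?addr0 // => l lk.
  by rewrite (inj_eq enum_val_inj) (negPf lk) mulr0.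
split=> [i iA|j jE].
  rewrite /x big1 // => l _; case: eqP => [li|]; last by rewrite mulr0.
  by rewrite -li enum_valP in iA.
under eq_bigr do rewrite /x mulr_suml.
rewrite exchange_big /=.
have /rowP/(_ (enum_rank_in jE j)) := uN0; rewrite !mxE; apply: etrans.
apply: eq_bigr => l _; rewrite !mxE enum_rankK_in //.
rewrite (bigD1 (enum_val l)) //= eqxx mulr1 big1 ?addr0 // => i /negPf il.
by rewrite eq_sym il mulr0 mul0r.
Qed.

(** The block triangular determinant, with blocks given by a predicate so that the indices need no
    reordering: [A] is the product of the two matrices on the right. *)
Lemma det_block_pred (R : comPzRingType) n (P : pred 'I_n) (A : 'M[R]_n) :
  (forall i j, P i -> ~~ P j -> A i j = 0) ->
  \det A = \det (\matrix_(i, j) (if P i then A i j else (i == j)%:R))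
         * \det (\matrix_(i, j) (if P i then (i == j)%:R else A i j)).
Proof.
move=> A0; rewrite -det_mulmx; congr (\det _); apply/matrixP=> i j.
rewrite !mxE; case Pi: (P i); last first.
  rewrite (bigD1 i) //= !mxE Pi eqxx mul1r big1 ?addr0 // => k ki.
  by rewrite !mxE Pi eq_sym (negPf ki) mul0r.
rewrite (bigD1 j) //= !mxE Pi eqxx big1 => [|k kj].
  by case Pj: (P j); rewrite ?mulr1 ?addr0 // A0 ?Pj // mul0r.
rewrite !mxE Pi; case Pk: (P k); first by rewrite (negPf kj) mulr0.
by rewrite A0 ?Pk // mul0r.
Qed.

Lemma det_neq0_left (F : fieldType) n (A : 'M[F]_n) :
  (forall x : 'rV_n, x *m A = 0 -> x = 0) -> \det A != 0.
Proof.
move=> inj; apply/negP=> /det0P [x x0 xA].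
by rewrite (inj x xA) eqxx in x0.
Qed.

Lemma det_neq0_right (F : fieldType) n (A : 'M[F]_n) (z : 'cV_n) :
  \det A != 0 -> A *m z = 0 -> z = 0.
Proof.
move=> dA Az0; rewrite -[z]mul1mx -(@mulVmx _ _ A) ?unitmxE ?unitfE //.
by rewrite -mulmxA Az0 mulmx0.
Qed.

Lemma sum_delta (R : pzRingType) (X : finType) (g : X -> R) x :
  \sum_y g y * (y == x)%:R = g x.
Proof.
rewrite (bigD1 x) //= eqxx mulr1 big1 ?addr0 // => y /negPf ->.
by rewrite mulr0.
Qed.

End LinearAlgebra.

(** * Mates in a bitrade and the row across an edge *)

Section Bitrade.

Variables (RT CT ST : finType) (W B : {set RT * CT * ST}).
Hypothesis bitWB : latin_bitrade W B.

Local Notation triple := (RT * CT * ST)%type.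
Local Notation vertex := (RT + CT + ST)%type.
Implicit Types (t u : triple) (v : vertex).

Lemma partial_latin_inj (T : {set triple}) t u : partial_latin T ->
  t \in T -> u \in T -> (1 < agreements t u)%N -> t = u.
Proof.
move=> plT tT uT; case: (eqVneq t u) => // tu; rewrite ltnNge.
by rewrite plT.
Qed.

(** Here [pr] keeps two of the three coordinates. It is injective on [W] and on [B], and mates give
    it the same image on both. *)
Lemma sum_mates (V : nmodType) (X : finType) (pr : triple -> X) (F : X -> V) :
  (forall t u, pr t = pr u -> (1 < agreements t u)%N) ->
  (forall T1 T2, has_mates T1 T2 -> forall t : triple, t \in T1 ->
     exists2 u, u \in T2 & pr u = pr t) ->
  \sum_(t in W) F (pr t) = \sum_(t in B) F (pr t).
Proof.
move=> prag prmate; case: bitWB => _ [plW plB] mWB mBW.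
have prinj T : partial_latin T -> {in T &, injective pr}.
  by move=> plT t u tT uT /prag; apply: partial_latin_inj plT tT uT.
rewrite -(big_imset F (prinj W plW)) -(big_imset F (prinj B plB)) /=.
apply: eq_bigl => x; apply/imsetP/imsetP=> -[t tT ->].
  by case: (prmate _ _ mWB t tT) => u uT <-; exists u.
by case: (prmate _ _ mBW t tT) => u uT <-; exists u.
Qed.

Lemma sum_mates_sym (V : nmodType) (F : RT * CT -> V) :
  \sum_(t in W) F t.1 = \sum_(t in B) F t.1.
Proof.
apply: (@sum_mates _ _ (fun t => t.1)) => [t u tu|T1 T2 m [[r c] s] tT].
  by rewrite /agreements tu !eqxx.
by case: (m r c s tT) => _ _ [s' [[_ uT] _]]; exists (r, c, s').
Qed.

Lemma sum_mates_col (V : nmodType) (F : RT * ST -> V) :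
  \sum_(t in W) F (t.1.1, t.2) = \sum_(t in B) F (t.1.1, t.2).
Proof.
apply: (@sum_mates _ _ (fun t => (t.1.1, t.2)))
  => [t u [tr ts]|T1 T2 m [[r c] s] tT].
  by rewrite /agreements tr ts !eqxx addn1 ltnS addn_gt0.
by case: (m r c s tT) => _ [c' [[_ uT] _]] _; exists (r, c', s).
Qed.

Lemma sum_mates_row (V : nmodType) (F : CT * ST -> V) :
  \sum_(t in W) F (t.1.2, t.2) = \sum_(t in B) F (t.1.2, t.2).
Proof.
apply: (@sum_mates _ _ (fun t => (t.1.2, t.2)))
  => [t u [tc ts]|T1 T2 m [[r c] s] tT].
  by rewrite /agreements tc ts !eqxx addn1 ltnS addn_gt0 orbT.
by case: (m r c s tT) => [[r' [[_ uT] _]] _ _]; exists (r', c, s).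
Qed.

(* For t in W the default is never reached, by [opp_mem]. *)
Definition opp (t : triple) : RT :=
  odflt t.1.1 [pick r | (r, t.1.2, t.2) \in B].

Lemma opp_mem t : t \in W -> (opp t, t.1.2, t.2) \in B.
Proof.
case: t => [[r c] s] tW; rewrite /opp /=; case: pickP => [//|no].
case: bitWB => _ _ /(_ r c s tW)[[r' [[_ r'B] _]] _ _] _.
by rewrite no in r'B.
Qed.

Lemma opp_eq t r : (r, t.1.2, t.2) \in B -> opp t = r.
Proof.
move=> rB; rewrite /opp; case: pickP => [r' r'B /=|/(_ r)]; last by rewrite rB.
case: bitWB => _ [_ plB] _ _.
have [] // : (r', t.1.2, t.2) = (r, t.1.2, t.2).
apply: (partial_latin_inj plB) => //.
by rewrite /agreements !eqxx addn1 ltnS addn_gt0 orbT.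
Qed.

Lemma opp_neq t : t \in W -> opp t != t.1.1.
Proof.
case: t => [[r c] s] tW /=.
case: bitWB => _ _ /(_ r c s tW)[[r' [[r'r r'B] _]] _ _] _.
by rewrite (@opp_eq (r, c, s) r').
Qed.

Lemma opp_onto r c s : (r, c, s) \in B ->
  exists2 t, t \in W & [/\ t.1.2 = c, t.2 = s & opp t = r].
Proof.
move=> rB; case: bitWB => _ _ _ /(_ r c s rB)[[r' [[_ r'W] _]] _ _].
by exists (r', c, s) => //; split=> //; apply: opp_eq.
Qed.

(** * Potential differences along edges and dual arcs *)

Definition row_jump (f : vertex -> rat) t : rat :=
  f (row_vertex CT ST t.1.1) - f (row_vertex CT ST (opp t)).
Definition colsym_jump (f : vertex -> rat) t : rat :=
  f (col_vertex RT ST t.1.2) - f (sym_vertex RT CT t.2).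

Lemma sum_opp (F : RT -> CT -> ST -> rat) :
  \sum_(t in W) F (opp t) t.1.2 t.2 = \sum_(t in B) F t.1.1 t.1.2 t.2.
Proof.
(* [G] evaluates [F] at the triple of [B] on a given column-symbol edge, which [opp] also reads from
   the [W] side. *)
pose G (x : CT * ST) := if [pick r | (r, x.1, x.2) \in B] is Some r
  then F r x.1 x.2 else 0.
transitivity (\sum_(t in W) G (t.1.2, t.2)); last first.
  rewrite sum_mates_row; apply: eq_bigr => -[[r c] s] tB; rewrite /G /=.
  have := @opp_eq (r, c, s) r tB; rewrite /opp /=.
  by case: pickP => [r' _ /= ->|/(_ r)] //; rewrite tB.
apply: eq_bigr => t tW; have := opp_mem tW; rewrite /G /opp.
by case: pickP => //= no; rewrite no.
Qed.

(* Expanding the product, the terms read off W and those read across the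
   column-symbol edges both become the same sum over B. *)
Lemma jump_orthogonal f g :
  \sum_(t in W) colsym_jump f t * row_jump g t = 0.
Proof.
pose gr r := g (row_vertex CT ST r).
pose fc c := f (col_vertex RT ST c).
pose fs s := f (sym_vertex RT CT s).
rewrite (eq_bigr (fun t => (fc t.1.2 * gr t.1.1 - fs t.2 * gr t.1.1)
   - (fc t.1.2 - fs t.2) * gr (opp t))); last first.
  by move=> t _; rewrite /colsym_jump /row_jump mulrBr mulrBl.
rewrite sumrB (sum_opp (fun r c s => (fc c - fs s) * gr r)) sumrB.
rewrite (sum_mates_sym (fun x => fc x.2 * gr x.1)).
rewrite (sum_mates_col (fun x => fs x.2 * gr x.1)).
by rewrite -!sumrB big1 // => t _; rewrite mulrBl subrr.
Qed.

Lemma row_jump_sum0 g : \sum_(t in W) row_jump g t = 0.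
Proof.
(* The indicator of the columns has jump 1 along every column-symbol edge. *)
pose f v : rat := if v is inl (inr _) then 1 else 0.
rewrite -[RHS](jump_orthogonal f g); apply: eq_bigr => t _.
by rewrite /colsym_jump /f /= subr0 mul1r.
Qed.

(* Orthogonality makes the sum of the squared row jumps off t0 vanish; the jump
   at t0 then vanishes because all row jumps sum to 0. *)
Lemma row_jump_eq0 t0 f : t0 \in W -> colsym_jump f t0 = 0 ->
  (forall t, t \in W -> t != t0 ->
     row_jump f t = 0 \/ row_jump f t + colsym_jump f t = 0) ->
  forall t, t \in W -> row_jump f t = 0.
Proof.
move=> t0W f0 H.
have sq0 : \sum_(t in W | t != t0) row_jump f t ^+ 2 = 0.
  have := jump_orthogonal f f; rewrite (bigD1 t0) //= f0 mul0r add0r => jj0.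
  apply: oppr_inj; rewrite oppr0 -sumrN -[RHS]jj0.
  apply: eq_bigr => t /andP[tW tt0].
  case: (H t tW tt0) => [->|/eqP]; first by rewrite mulr0 expr0n oppr0.
  by rewrite addrC addr_eq0 => /eqP ->; rewrite mulNr expr2.
have j0 t : t \in W -> t != t0 -> row_jump f t = 0.
  move=> tW tt0; apply/eqP; rewrite -sqrf_eq0; apply/eqP.
  move/psumr_eq0P: sq0 => -> //; last by rewrite tW.
  by move=> u _; apply: sqr_ge0.
move=> t tW; case: (eqVneq t t0) => [->|]; last exact: j0.
have := row_jump_sum0 f; rewrite (bigD1 t0) //= big1 ?addr0 //.
by move=> u /andP[]; apply: j0.
Qed.

(** * Connectedness of the dual graph and of the link of a row *)

Lemma opp_connected (X : eqType) (g : RT -> X) : connected W B ->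
  (forall t, t \in W -> g t.1.1 = g (opp t)) ->
  {in W &, forall t u, g t.1.1 = g u.1.1}.
Proof.
move=> conn gopp t0 u0 t0W u0W; apply/eqP; apply/negPn/negP=> neq.
apply: conn.
(* If [g] took two values, cutting both sets by whether [g] takes its value at [t0] would split the
   bitrade: mates across a column-symbol edge stay on one side by [oppB], and all other mates share
   the row. *)
pose sel (T : {set triple}) (b : bool) :=
  [set t in T | (g t.1.1 == g t0.1.1) == b].
have oppB r c s r' : (r, c, s) \in B -> (r', c, s) \in W -> g r' = g r.
  by move=> rB r'W; rewrite (gopp _ r'W); congr g; apply: opp_eq.
have bit b : (exists2 t, t \in W & (g t.1.1 == g t0.1.1) == b) ->
    latin_bitrade (sel W b) (sel B b).
  case=> t tW tb; case: bitWB => _ [plW plB] mWB mBW.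
  split.
  - split; apply/set0Pn; first by exists t; rewrite inE tW.
    exists (opp t, t.1.2, t.2).
    by rewrite inE opp_mem //= -gopp.
  - by split=> u v; rewrite !inE => /andP[? _] /andP[? _]; auto.
  - move=> r c s; rewrite inE /= => /andP[uW ub].
    case: (mWB r c s uW) => -[r' [[r'r r'B] ur]]
      [c' [[c'c c'B] uc]] [s' [[s's s'B] us]].
    split; [exists r'|exists c'|exists s']; split.
    + by rewrite inE r'B /= -(oppB _ _ _ _ r'B uW).
    + by move=> x [xr]; rewrite inE => /andP[xB _]; apply: ur.
    + by rewrite inE c'B.
    + by move=> x [xr]; rewrite inE => /andP[xB _]; apply: uc.
    + by rewrite inE s'B.
    + by move=> x [xr]; rewrite inE => /andP[xB _]; apply: us.
  - move=> r c s; rewrite inE /= => /andP[uW ub].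
    case: (mBW r c s uW) => -[r' [[r'r r'B] ur]]
      [c' [[c'c c'B] uc]] [s' [[s's s'B] us]].
    split; [exists r'|exists c'|exists s']; split.
    + by rewrite inE r'B /= (oppB _ _ _ _ uW r'B).
    + by move=> x [xr]; rewrite inE => /andP[xB _]; apply: ur.
    + by rewrite inE c'B.
    + by move=> x [xr]; rewrite inE => /andP[xB _]; apply: uc.
    + by rewrite inE s'B.
    + by move=> x [xr]; rewrite inE => /andP[xB _]; apply: us.
exists (sel W true), (sel B true), (sel W false), (sel B false); split.
- by apply: bit; exists t0; rewrite ?eqxx.
- by apply: bit; exists u0 => //; rewrite eqbF_neg eq_sym.
- by apply/setP=> t; rewrite !inE -andb_orr; case: (_ == g _); rewrite andbT.
- by apply/setP=> t; rewrite !inE -andb_orr; case: (_ == g _); rewrite andbT.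
- by apply/setP=> t; rewrite !inE; case: (_ == g _); rewrite /= ?andbF.
Qed.

(** The triples with [t.1.1 = r] or [opp t = r] are the edges of the link of [r]. Since [psi_row] at
    [r] is a single cycle, and [a'] is unchanged when it moves a symbol past a column, the values
    agree all around the link. *)
Lemma link_connected (X : eqType) (a : CT -> X) (a' : ST -> X) r :
  separated W B -> r \in rows W ->
  (forall t, t \in W -> t.1.1 = r \/ opp t = r -> a t.1.2 = a' t.2) ->
  forall t u, t \in W -> u \in W -> t.1.1 = r \/ opp t = r ->
    u.1.1 = r \/ opp u = r -> a t.1.2 = a u.1.2.
Proof.
case=> sep _ _ rW aE; have [p [_ pE porb]] := sep r rW.
set D := [set s | _] in pE porb.
have aB c s : (r, c, s) \in B -> a c = a' s.
  case/opp_onto=> t tW [<- <- tr]; apply: aE => //; by right.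
have step s : s \in D -> p s \in D /\ a' (p s) = a' s.
  move=> sD; split; first by rewrite -(porb s sD) -{1}[p]expg1 mem_porbit.
  have := pE s (p s) sD; rewrite eqxx => /esym/existsP[c /andP[tW uB]].
  by rewrite -(aB _ _ uB); apply: (aE _ tW); left.
have const s s' : s \in D -> s' \in D -> a' s = a' s'.
  move=> sD s'D; move: s'D; rewrite -(porb s sD) => /porbitP[k ->].
  suff [] : (p ^+ k)%g s \in D /\ a' ((p ^+ k)%g s) = a' s by [].
  elim: k => [|k [kD kE]]; first by rewrite expg0 perm1.
  by rewrite expgSr permM; case: (step _ kD) => ? ->.
have main t : t \in W -> t.1.1 = r \/ opp t = r ->
    exists2 s, s \in D & a t.1.2 = a' s.
  move=> tW []; case: t tW => [[r' c] s] tW /= E.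
    subst r'; exists s; first by rewrite inE; apply/existsP; exists c.
    by apply: (aE _ tW); left.
  have := opp_mem tW; rewrite E /= => bB.
  case: bitWB => _ _ _ /(_ _ _ _ bB)[_ _ [s' [[_ s'W] _]]].
  exists s'; first by rewrite inE; apply/existsP; exists c.
  by apply: (aE _ s'W); left.
move=> t u tW uW tr ur; have [s sD ->] := main t tW tr.
by have [s' s'D ->] := main u uW ur; apply: const.
Qed.

Lemma opp_rows t : t \in W -> opp t \in rows W.
Proof.
move/opp_mem=> tB; case: bitWB => _ _ _ /(_ _ _ _ tB)[_ [c [[_ cW] _]] _].
by apply/imsetP; exists (opp t, c, t.2).
Qed.

(** * Signed incidence vectors *)

Lemma mem_vertices_of v t : (v \in vertices_of t) =
  match v with
  | inl (inl r) => r == t.1.1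
  | inl (inr c) => c == t.1.2
  | inr s => s == t.2
  end.
Proof. by case: v => [[r|c]|s]; rewrite !inE ?orbF. Qed.

Definition is_row v : bool := if v is inl (inl _) then true else false.

Definition signed v t : rat :=
  match v with
  | inl (inl r) => (r == t.1.1)%:R - (r == opp t)%:R
  | inl (inr c) => (c == t.1.2)%:R
  | inr s => - (s == t.2)%:R
  end.

Lemma sum_signed f t :
  \sum_v f v * signed v t = row_jump f t + colsym_jump f t.
Proof.
rewrite big_sumType /= big_sumType /= -addrA; congr (_ + _).
  under eq_bigr do rewrite mulrBr.
  by rewrite sumrB !sum_delta.
under [X in _ + X]eq_bigr do rewrite mulrN.
by rewrite sumrN !sum_delta.
Qed.

Lemma signed_row v t : is_row v -> signed v t = row_jump (fun w => (v == w)%:R) t.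
Proof. by case: v => [[r|c]|s]. Qed.

Lemma signed_colsym v t :
  ~~ is_row v -> signed v t = colsym_jump (fun w => (v == w)%:R) t.
Proof.
case: v => [[r|c]|s] //= _; rewrite /colsym_jump /=.
  by rewrite subr0.
by rewrite sub0r.
Qed.

Lemma signed_eq0 v t : ~~ is_row v -> v \notin vertices_of t -> signed v t = 0.
Proof.
by case: v => [[r|c]|s] //= _; rewrite mem_vertices_of => /negPf ->; rewrite ?oppr0.
Qed.

(** * Acyclicity of a matching on the rows *)

Hypotheses (sepWB : separated W B) (connWB : connected W B).

Definition incident_row t r : bool := (t.1.1 == r) || (opp t == r).

Definition vanishes_around (f : vertex -> rat) r : bool :=
  [forall t in W, incident_row t r ==> (f (col_vertex RT ST t.1.2) == 0)].

(** The link of [r] is connected, so a single edge on it decides. *)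
Lemma vanishes_aroundE f r t : r \in rows W ->
  (forall u, u \in W -> incident_row u r -> colsym_jump f u = 0) ->
  t \in W -> incident_row t r ->
  vanishes_around f r = (f (col_vertex RT ST t.1.2) == 0).
Proof.
move=> rW f0 tW tr; apply/idP/idP=> [/forall_inP/(_ t tW)|/eqP fc0].
  by rewrite tr.
apply/forall_inP=> u uW; apply/implyP=> ur.
have inc w : incident_row w r -> w.1.1 = r \/ opp w = r.
  by case/orP=> /eqP; [left|right].
rewrite -(@link_connected _ (fun c => f (col_vertex RT ST c))
  (fun s => f (sym_vertex RT CT s)) r sepWB rW _ t u tW uW); rewrite ?fc0 //; auto.
move=> v vW vr; apply/eqP; rewrite -subr_eq0; apply/eqP/f0 => //.
by rewrite /incident_row; case: vr => ->; rewrite eqxx ?orbT.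
Qed.

Variable t0 : triple.
Hypothesis t0W : t0 \in W.

(* An Euler characteristic count.  Enlarge U0 to a maximal closed set U, and let
   K be the set of edges touching the rows outside U.  The matching bounds |K :\ t0|
   by the number of vertices of A other than the row of t0, so the incidence
   vectors of A, restricted to K :\ t0, satisfy a linear relation f.  By
   orthogonality the row part and the column-symbol part of f vanish separately:
   the row part because f is 0 on U, the other because the rows outside U all
   lead to the row of t0. *)
Lemma matched_rows_acyclic (m : triple -> vertex) (U0 : {set RT}) :
  {in W :\ t0 &, injective m} ->
  (forall t, t \in W :\ t0 -> m t \in vertices_of t :\: vertices_of t0) ->
  U0 \subset rows W -> t0.1.1 \notin U0 ->
  (forall t, t \in W :\ t0 -> m t = row_vertex CT ST t.1.1 ->
     t.1.1 \in U0 -> opp t \in U0) ->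
  U0 = set0.
Proof.
move=> m_inj mP U0W U0r0 U0P; apply/eqP/negPn/negP=> U0n0.
pose closed (U : {set RT}) := [&& U \subset rows W, t0.1.1 \notin U
  & [forall t in W :\ t0, (m t == row_vertex CT ST t.1.1) ==>
       (t.1.1 \in U) ==> (opp t \in U)]].
have clU0 : closed U0.
  rewrite /closed U0W U0r0; apply/forall_inP=> t tW.
  by apply/implyP=> /eqP mt; apply/implyP; apply: U0P.
have [U /maxsetP[/and3P[UW Ur0 /forall_inP UP] maxU] U0U] := maxset_exists clU0.
have {}UP t : t \in W :\ t0 -> m t = row_vertex CT ST t.1.1 ->
    t.1.1 \in U -> opp t \in U.
  by move=> /UP /implyP tP /eqP/tP /implyP.
have [r1 r1U] : exists r1, r1 \in U.
  by case/set0Pn: U0n0 => r1 /(subsetP U0U); exists r1.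
pose K := [set t in W | (t.1.1 \notin U) || (opp t \notin U)].
pose A := [set v : vertex | if v is inl (inl r) then r \in rows W :\: U
  else (v \notin vertices_of t0) && [exists t in K, v \in vertices_of t]].
have rowW t : t \in W -> t.1.1 \in rows W by move=> tW; apply/imsetP; exists t.
(* [m] maps [K :\ t0] into [A] but misses the row of [t0], which makes the inequality strict. A
   triple of [K] matched to its row has that row outside [U], since otherwise closedness would put
   both its rows in [U]. *)
have cardKA : (#|K :\ t0| < #|A|)%N.
  have r0A : row_vertex CT ST t0.1.1 \in A by rewrite inE /= in_setD Ur0 rowW.
  rewrite (cardsD1 (row_vertex CT ST t0.1.1) A) r0A add1n ltnS.
  rewrite -(card_in_imset (f := m)); last first.
    move=> t u; rewrite !inE => /and3P[tt0 tW _] /and3P[ut0 uW _].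
    by apply: m_inj; rewrite !inE ?tt0 ?ut0.
  apply/subset_leq_card/subsetP=> _ /imsetP[t tK ->].
  have tW0 : t \in W :\ t0 by move: tK; rewrite !inE => /and3P[-> ->].
  have tK' : t \in K by move: tK; rewrite inE => /andP[].
  have := mP t tW0; rewrite inE => /andP[mt0 mt].
  rewrite in_setD1; apply/andP; split.
    by apply: contraNneq mt0 => ->; rewrite mem_vertices_of /= eqxx.
  rewrite inE; case E: (m t) => [[r|c]|s]; rewrite E in mt mt0; last first.
  - by rewrite mt0; apply/exists_inP; exists t.
  - by rewrite mt0; apply/exists_inP; exists t.
  move: mt; rewrite mem_vertices_of => /eqP Er; subst r.
  move: tK' tW0; rewrite !inE => /andP[tW] UU tt0.
  rewrite rowW // andbT; case/orP: UU => //; apply: contraNN; apply: UP => //.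
  by rewrite !inE.
have [f [v0 fv0] [fA fK]] := exists_linear_relation signed cardKA.
have {}fK t : t \in K :\ t0 -> row_jump f t + colsym_jump f t = 0.
  by move/fK; rewrite sum_signed.
have f_t0 v : ~~ is_row v -> v \in vertices_of t0 -> f v = 0.
  by move=> vr vt0; apply: fA; rewrite inE; case: v vr vt0 => [[r|c]|s] //= _ ->.
have cs_t0 : colsym_jump f t0 = 0.
  by rewrite /colsym_jump !f_t0 ?subrr // mem_vertices_of /= eqxx.
have fU r : r \in U -> f (row_vertex CT ST r) = 0.
  by move=> rU; apply: fA; rewrite inE /= in_setD rU.
(* On [K] the linear relation applies; off [K] both rows of [t] lie in [U], where [f] is 0. *)
have rj0 : forall t, t \in W -> row_jump f t = 0.
  apply: (row_jump_eq0 t0W cs_t0) => t tW tt0.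
  case tK: (t \in K); first by right; apply: fK; rewrite in_setD1 tt0.
  move: tK; rewrite inE tW /= => /norP[/negPn tU /negPn oU].
  by left; rewrite /row_jump !fU ?subrr.
have csK t : t \in K -> colsym_jump f t = 0.
  move=> tK; case: (eqVneq t t0) => [->//|tt0].
  have tW : t \in W by move: tK; rewrite inE => /andP[].
  by have := fK t; rewrite (rj0 t tW) add0r in_setD1 tt0; apply.
(* [f] is constant on the rows by connectedness, and is 0 at [r1] in [U]. *)
have frow r : r \in rows W -> f (row_vertex CT ST r) = 0.
  have /imsetP[u uW Eu] := subsetP UW _ r1U.
  case/imsetP=> t tW ->; rewrite -(fU r1 r1U) Eu.
  apply: (@opp_connected _ (fun r => f (row_vertex CT ST r))) => // w wW.
  by apply/eqP; rewrite -subr_eq0; apply/eqP/rj0.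
have incK t r : t \in W -> r \notin U -> incident_row t r -> t \in K.
  by move=> tW rU; rewrite inE tW => /orP[/eqP->|/eqP->]; rewrite rU ?orbT.
have vanE r t : r \in rows W -> r \notin U -> t \in W -> incident_row t r ->
    vanishes_around f r = (f (col_vertex RT ST t.1.2) == 0).
  move=> rW rU; apply: vanishes_aroundE => // u uW ur.
  exact/csK/(incK _ r).
pose Bad := [set r in rows W | (r \notin U) && ~~ vanishes_around f r].
have r0_van : vanishes_around f t0.1.1.
  rewrite (vanE _ t0) ?rowW // ?f_t0 ?mem_vertices_of /= ?eqxx //.
  by rewrite /incident_row eqxx.
(* An edge whose two rows are outside [U] lies on both links, so vanishing around one row gives
   vanishing around the other. Hence [U :|: Bad] is closed, and maximality of [U] leaves [Bad]
   empty. *)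
have clUB : closed (U :|: Bad).
  apply/and3P; split.
  - by rewrite subUset UW; apply/subsetP=> r; rewrite inE => /andP[].
  - by rewrite !inE (negPf Ur0) r0_van andbF.
  apply/forall_inP=> t tW0; apply/implyP=> /eqP mt; apply/implyP.
  have tW : t \in W by move: tW0; rewrite !inE => /andP[].
  rewrite !inE => /orP[/(UP t tW0 mt)->//|/and3P[rW rU nvan]].
  rewrite opp_rows //=; case oU: (opp t \in U) => //=.
  apply: contraNN nvan => van.
  rewrite (vanE _ t) //; last by rewrite /incident_row eqxx.
  by rewrite -(vanE (opp t)) ?opp_rows ?oU // /incident_row eqxx orbT.
have van r : r \in rows W -> r \notin U -> vanishes_around f r.
  move=> rW rU; apply/negPn/negP=> nvan; move/negP: rU; apply.
  by rewrite -(maxU _ clUB (subsetUl _ _)) !inE rW nvan andbT orbN.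
have colK t : t \in K -> f (col_vertex RT ST t.1.2) = 0.
  move=> tK; have := tK; rewrite inE => /andP[tW tU]; apply/eqP.
  case/orP: tU => tU.
    by rewrite -(vanE t.1.1) ?van ?rowW // /incident_row eqxx.
  by rewrite -(vanE (opp t)) ?van ?opp_rows // /incident_row eqxx orbT.
have symK t : t \in K -> f (sym_vertex RT CT t.2) = 0.
  move=> tK; apply/eqP; rewrite -(colK t tK) eq_sym -subr_eq0.
  by apply/eqP/csK.
move/eqP: fv0; apply; case v0A: (v0 \in A); last by rewrite fA ?v0A.
move: v0A; rewrite inE; case: v0 => [[r|c]|s].
- by rewrite inE => /andP[_ rW]; apply: frow.
- case/andP=> _ /exists_inP[t tK]; rewrite mem_vertices_of => /eqP->.
  exact: colK.
case/andP=> _ /exists_inP[t tK]; rewrite mem_vertices_of => /eqP->.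
exact: symK.
Qed.

(** * The signed matrix *)

Variables (n : nat) (rho : 'I_n -> vertex) (kappa : 'I_n -> triple).
Hypothesis rhoP : ordering_of rho (vertices W :\: vertices_of t0).
Hypothesis kappaP : ordering_of kappa (W :\ t0).

Lemma rho_mem i : rho i \in vertices W :\: vertices_of t0.
Proof. by case: rhoP => _ <-; apply/imsetP; exists i. Qed.

Lemma kappa_mem j : kappa j \in W :\ t0.
Proof. by case: kappaP => _ <-; apply/imsetP; exists j. Qed.

Lemma kappa_onto t : t \in W -> t != t0 -> exists j, t = kappa j.
Proof.
move=> tW tt0; have : t \in W :\ t0 by rewrite !inE tt0.
by case: kappaP => _ <- /imsetP[j _ ->]; exists j.
Qed.

Lemma mem_vertices v : (v \in vertices W) =
  match v with
  | inl (inl r) => r \in rows W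
  | inl (inr c) => c \in cols W
  | inr s => s \in syms W
  end.
Proof.
have inj1 : injective (@row_vertex RT CT ST) by move=> x y [].
have inj2 : injective (@col_vertex RT CT ST) by move=> x y [].
have inj3 : injective (@sym_vertex RT CT ST) by move=> x y [].
rewrite /vertices !in_setU; case: v => [[r|c]|s].
- rewrite (mem_imset _ r inj1); case: (r \in _) => //=.
  by apply/norP; split; apply/imsetP=> -[].
- rewrite (mem_imset _ c inj2); case: (c \in _); rewrite ?orbT //= orbF.
  by apply/norP; split; apply/imsetP=> -[].
- rewrite (mem_imset _ s inj3); case: (s \in _); rewrite ?orbT //= orbF.
  by apply/norP; split; apply/imsetP=> -[].
Qed.

Definition signed_mx : 'M[rat]_n := \matrix_(i, j) signed (rho i) (kappa j).

(** A left kernel vector is a potential [f] vanishing on the vertices of [t0], whose two jumps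
    cancel off [t0]. By orthogonality each jump vanishes separately, and connectedness carries the
    value 0 from [t0] to all vertices. *)
Lemma det_signed_mx : \det signed_mx != 0.
Proof.
apply: det_neq0_left => x xY.
pose f v := \sum_i x 0 i * (rho i == v)%:R.
have frho i : f (rho i) = x 0 i.
  rewrite /f (eq_bigr (fun k => x 0 k * (k == i)%:R)) ?sum_delta // => k _.
  by rewrite (inj_eq (proj1 rhoP)).
suff f0 : forall v, v \in vertices W -> f v = 0.
  apply/rowP=> i; rewrite mxE -frho f0 //.
  by have := rho_mem i; rewrite inE => /andP[].
have f_t0 v : v \in vertices_of t0 -> f v = 0.
  move=> vt0; rewrite /f big1 // => i _; case: eqP => [E|]; last by rewrite mulr0.
  by have := rho_mem i; rewrite inE E vt0.
have fW t : t \in W -> t != t0 -> row_jump f t + colsym_jump f t = 0.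
  move=> tW tt0; have [j ->] := kappa_onto tW tt0.
  rewrite -sum_signed; under eq_bigr do rewrite /f mulr_suml.
  rewrite exchange_big /=; have /rowP/(_ j) := xY; rewrite !mxE; apply: etrans.
  apply: eq_bigr => i _; rewrite mxE.
  rewrite (bigD1 (rho i)) //= eqxx mulr1 big1 ?addr0 // => v /negPf vi.
  by rewrite eq_sym vi mulr0 mul0r.
have cs_t0 : colsym_jump f t0 = 0.
  by rewrite /colsym_jump !f_t0 ?subrr // mem_vertices_of /= eqxx.
have rj0 : forall t, t \in W -> row_jump f t = 0.
  by apply: (row_jump_eq0 t0W cs_t0) => t tW tt0; right; apply: fW.
have csW t : t \in W -> colsym_jump f t = 0.
  move=> tW; case: (eqVneq t t0) => [->//|tt0].
  by have := fW t tW tt0; rewrite (rj0 t tW) add0r.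
have rowW t : t \in W -> t.1.1 \in rows W by move=> tW; apply/imsetP; exists t.
have vanE r t : r \in rows W -> t \in W -> incident_row t r ->
    vanishes_around f r = (f (col_vertex RT ST t.1.2) == 0).
  by move=> rW; apply: vanishes_aroundE => // u uW _; apply: csW.
have van t : t \in W -> f (col_vertex RT ST t.1.2) = 0.
  move=> tW; apply/eqP; rewrite -(vanE t.1.1) ?rowW // /incident_row ?eqxx //.
  (* Connectedness is applied to the boolean function [vanishes_around f], which is unchanged along
     each arc because its edge lies on the links of both end rows. *)
  rewrite (opp_connected connWB _ tW t0W) => [|u uW].
    rewrite (vanE _ t0) ?rowW // /incident_row ?eqxx // f_t0 //.
    by rewrite mem_vertices_of /=.
  rewrite !(vanE _ u) ?rowW ?opp_rows // /incident_row eqxx ?orbT //.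
move=> v; rewrite mem_vertices; case: v => [[r|c]|s].
- case/imsetP=> t tW ->.
  rewrite (@opp_connected _ (fun r => f (row_vertex CT ST r)) connWB _ t t0) //.
    by rewrite f_t0 // mem_vertices_of /=.
  by move=> u uW; apply/eqP; rewrite -subr_eq0; apply/eqP/rj0.
- by case/imsetP=> t tW ->; apply: van.
case/imsetP=> t tW ->; apply/eqP.
by rewrite -(van t tW) eq_sym -subr_eq0; apply/eqP/csW.
Qed.

(** The sum omits [t0], but the missing term is 0 because the column or symbol [rho i] is not a
    vertex of [t0]. *)
Lemma signed_mx_orthogonal i j : ~~ is_row (rho i) -> is_row (rho j) ->
  \sum_k signed_mx i k * signed_mx j k = 0.
Proof.
move=> ri rj; under eq_bigr do rewrite !mxE.
pose G t := signed (rho i) t * signed (rho j) t.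
have -> : \sum_k signed (rho i) (kappa k) * signed (rho j) (kappa k)
    = \sum_(t in W :\ t0) G t.
  case: kappaP => kinj <-; rewrite big_imset //=.
  by move=> k l _ _; apply: kinj.
transitivity (\sum_(t in W) G t).
  have G0 : G t0 = 0.
    rewrite /G signed_eq0 ?mul0r //.
    by have := rho_mem i; rewrite inE => /andP[].
  rewrite [RHS](bigD1 t0) //= G0 add0r.
  by apply: eq_bigl => t; rewrite !inE andbC.
rewrite -[RHS](jump_orthogonal (fun w => (rho i == w)%:R)
  (fun w => (rho j == w)%:R)).
by apply: eq_bigr => t _; rewrite /G signed_colsym // signed_row.
Qed.

(** * Determinants attached to a matching *)

Definition matching (s : 'S_n) : bool :=
  [forall i, rho i \in vertices_of (kappa (s i))].

Definition row_matching_mx (s : 'S_n) : 'M[rat]_n :=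
  \matrix_(i, j) (if is_row (rho i) then (j == s i)%:R else signed_mx i j).

(** The Gram determinant of the column and symbol vectors, padded by the identity on the rows: the
    block of [X Y^T] common to all matchings. *)
Definition colsym_gram_det : rat :=
  \det (\matrix_(i, j) (if ~~ is_row (rho i)
     then \sum_k signed_mx i k * signed_mx j k else (i == j)%:R)).

(** It is a factor of the determinant of [Y Y^T], which is block triangular by orthogonality and
    invertible with [Y]. *)
Lemma colsym_gram_det_neq0 : colsym_gram_det != 0.
Proof.
have : \det (signed_mx *m signed_mx^T) != 0.
  by rewrite det_mulmx det_tr mulf_neq0 ?det_signed_mx.
rewrite (@det_block_pred _ _ (fun i => ~~ is_row (rho i))) => [|i j ri rj].
  rewrite mulf_eq0 => /norP[g0 _]; apply: etrans g0; congr (_ != 0).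
  congr (\det _); apply/matrixP=> i j; rewrite !mxE; case: ifP => // _.
  by apply: eq_bigr => k _; rewrite [signed_mx^T _ _]mxE.
rewrite mxE -[RHS](@signed_mx_orthogonal i j) ?(negbNE rj) //.
by apply: eq_bigr => k _; rewrite [signed_mx^T _ _]mxE.
Qed.

Lemma matching_row s i : matching s -> is_row (rho i) ->
  rho i = row_vertex CT ST (kappa (s i)).1.1.
Proof.
move=> /forallP/(_ i); rewrite mem_vertices_of.
by case: (rho i) => [[r|c]|s'] //= /eqP ->.
Qed.

(** Acyclicity restated for indices; [I] will be the set of points moved by a permutation in the
    expansion of [det (1 - Q)]. *)
Lemma matching_closed_rows s (I : {set 'I_n}) : matching s ->
  (forall i, i \in I -> is_row (rho i) /\ exists2 j, j \in I &
     rho j = row_vertex CT ST (opp (kappa (s i)))) ->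
  I = set0.
Proof.
move=> ms IP.
(* The inverse of the matching; the default is not reached on [W :\ t0]. *)
pose m t := if [pick i | kappa (s i) == t] is Some i then rho i
  else row_vertex CT ST t.1.1.
have mE i : m (kappa (s i)) = rho i.
  rewrite /m; case: pickP => [j /eqP|/(_ i)]; last by rewrite eqxx.
  by move/(proj1 kappaP)/perm_inj => ->.
have onto t : t \in W :\ t0 -> exists i, t = kappa (s i).
  rewrite !inE => /andP[tt0 tW]; have [j ->] := kappa_onto tW tt0.
  by exists ((s^-1)%g j); rewrite permKV.
pose U := [set r | [exists i in I, rho i == row_vertex CT ST r]].
suff U0 : U = set0.
  apply/setP=> i; rewrite inE; apply/negP=> iI; have [ir _] := IP i iI.
  suff : (kappa (s i)).1.1 \in U by rewrite U0 inE.
  by rewrite inE; apply/exists_inP; exists i => //; rewrite -matching_row.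
apply: (@matched_rows_acyclic m).
- move=> t u /onto[i ->] /onto[j ->]; rewrite !mE.
  by move/(proj1 rhoP) ->.
- move=> t /onto[i ->]; rewrite mE inE; have := rho_mem i.
  by rewrite inE => /andP[-> _]; apply: (forallP ms).
- apply/subsetP=> r; rewrite inE => /exists_inP[i _ /eqP Ei].
  by have := rho_mem i; rewrite Ei inE mem_vertices => /andP[].
- rewrite inE; apply/negP=> /exists_inP[i _ /eqP Ei].
  by have := rho_mem i; rewrite Ei inE mem_vertices_of /= eqxx.
move=> t /onto[i ->]; rewrite mE => Ei; rewrite !inE => /exists_inP[k kI].
rewrite -Ei => /eqP/(proj1 rhoP) Ek; subst k.
have [_ [j jI Ej]] := IP i kI.
by apply/exists_inP; exists j => //; rewrite Ej.
Qed.

Lemma det_row_matching_mx s : matching s ->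
  \det (row_matching_mx s) * \det signed_mx = colsym_gram_det.
Proof.
move=> ms; rewrite -[\det signed_mx]det_tr -det_mulmx.
have XYrow i j : is_row (rho i) ->
    (row_matching_mx s *m signed_mx^T) i j = signed (rho j) (kappa (s i)).
  move=> ri; rewrite mxE (bigD1 (s i)) //= !mxE ri eqxx mul1r big1 ?addr0 //.
  by move=> k /negPf ki; rewrite !mxE ri ki mul0r.
have XYcs i j : ~~ is_row (rho i) -> (row_matching_mx s *m signed_mx^T) i j =
    \sum_k signed_mx i k * signed_mx j k.
  move=> /negPf ri; rewrite mxE; apply: eq_bigr => k _.
  by rewrite [row_matching_mx s i k]mxE ri [signed_mx^T _ _]mxE.
rewrite (@det_block_pred _ _ (fun i => ~~ is_row (rho i))) => [|i j ri rj].
  2: by rewrite XYcs // signed_mx_orthogonal // -[is_row _]negbK.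
rewrite -[RHS]mulr1; congr (_ * _).
  congr (\det _); apply/matrixP=> i j; rewrite !mxE; case: ifP => // ri.
  by rewrite -XYcs // mxE.
set Z := \matrix_(i, j) _.
have Zcs i j : ~~ is_row (rho i) -> Z i j = (i == j)%:R.
  by move=> ri; rewrite mxE ri.
have Zrow i j : is_row (rho i) -> Z i j = signed (rho j) (kappa (s i)).
  by move=> ri; rewrite mxE ri XYrow.
(* [Z] is [1 - Q] on the rows and the identity elsewhere. In a nonzero term, [p] fixes columns and
   symbols and sends each moved row to its image under [Q], so the moved points form a closed set,
   which is empty. *)
rewrite /determinant (bigD1 1%g) //= odd_perm1 mul1r.
rewrite [X in _ + X]big1 ?addr0 => [|p p1]; last first.
  apply/eqP; rewrite mulf_eq0 signr_eq0 /=; apply/negPn/negP=> /prodf_neq0 Zp.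
  have fixcs i : ~~ is_row (rho i) -> p i = i.
    move=> ri; have := Zp i isT; rewrite Zcs //.
    by case: (i =P p i) => [/esym //|]; rewrite eqxx.
  pose I := [set i | p i != i].
  suff I0 : I = set0.
    case/negP: p1; apply/eqP/permP=> i; rewrite perm1; apply/eqP/negPn/negP=> pi.
    by have /setP/(_ i) := I0; rewrite !inE pi.
  apply: (matching_closed_rows ms) => i; rewrite inE => pi.
  have ri : is_row (rho i) by apply/negPn/negP=> /fixcs E; rewrite E eqxx in pi.
  split=> //; exists (p i); first by rewrite inE (inj_eq perm_inj).
  have rpi : is_row (rho (p i)).
    by apply/negPn/negP=> /fixcs/perm_inj E; rewrite E eqxx in pi.
  have := Zp i isT; rewrite Zrow // signed_row // /row_jump.
  rewrite -matching_row // (inj_eq (proj1 rhoP)) (negPf pi) sub0r oppr_eq0.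
  by case: (_ =P row_vertex _ _ _) => [->//|]; rewrite eqxx.
rewrite big1 // => i _; rewrite perm1.
case ri: (is_row (rho i)); last by rewrite Zcs ?ri ?eqxx.
rewrite Zrow // signed_row // /row_jump -matching_row // eqxx.
rewrite (matching_row ms ri) /row_vertex.
have kW : kappa (s i) \in W by have := kappa_mem (s i); rewrite inE => /andP[].
case: eqP => [[E]|]; last by rewrite subr0.
by have := opp_neq kW; rewrite -E eqxx.
Qed.

(** * Uniqueness and sign of a matching *)

Definition is_col v : bool := if v is inl (inr _) then true else false.

Lemma vertices_of_kind v w t : v \in vertices_of t -> w \in vertices_of t ->
  is_row v = is_row w -> is_col v = is_col w -> v = w.
Proof.
rewrite !mem_vertices_of.
by case: v w => [[r|c]|s] [[r'|c']|s'] //= /eqP -> /eqP ->.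
Qed.

(* If p and s differ, the vector z, which records where p and s use a column
   vertex differently, is a nonzero element of the kernel of an invertible
   matrix. *)
Lemma matching_unique s p : matching s -> matching p ->
  (forall i, is_row (rho i) -> p i = s i) -> p = s.
Proof.
move=> ms mp agree.
have dX : \det (row_matching_mx s) != 0.
  apply: contraNneq colsym_gram_det_neq0 => E.
  by rewrite -(det_row_matching_mx ms) E mul0r.
pose col_at (q : 'S_n) j : rat := (is_col (rho ((q^-1)%g j)))%:R.
pose row_at (q : 'S_n) j : rat := (is_row (rho ((q^-1)%g j)))%:R.
pose sym_at (q : 'S_n) j : rat := 1 - row_at q j - col_at q j.
have row_eq j : is_row (rho ((s^-1)%g j)) = is_row (rho ((p^-1)%g j)).
  case rs: (is_row (rho ((s^-1)%g j))).
    by rewrite -{1}(permKV s j) -agree // permK rs.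
  case rp: (is_row (rho ((p^-1)%g j))) => //.
  by rewrite -{1}(permKV p j) agree // permK rp in rs.
(* Among the triples on a given column, only the one matched to it is matched to a column at all; so
   the sum is the same for every matching. *)
have colE (q : 'S_n) i : matching q -> is_col (rho i) ->
    \sum_j signed_mx i j * col_at q j = 1.
  move=> /forallP mq ci; rewrite (bigD1 (q i)) //= !mxE /col_at permK ci mulr1.
  rewrite big1 => [|j jqi].
    have := mq i; rewrite addr0 mem_vertices_of; move: ci.
    by case: (rho i) => [[r|c]|s'] //= _ ->.
  rewrite !mxE; case cj: (is_col _); last by rewrite mulr0.
  have := mq ((q^-1)%g j); rewrite permKV mem_vertices_of.
  have ne : rho ((q^-1)%g j) != rho i.
    rewrite (inj_eq (proj1 rhoP)); apply: contraNneq jqi => <-.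
    by rewrite permKV.
  move: ci cj ne; case: (rho i) => [[r|c]|s'] //= _.
  case: (rho _) => [[r'|c']|s''] //= _ ne /eqP E.
  by rewrite mulr1 -E; case: (c =P c') ne => [->|//]; rewrite eqxx.
have symE (q : 'S_n) i : matching q -> ~~ is_col (rho i) -> ~~ is_row (rho i) ->
    \sum_j signed_mx i j * sym_at q j = -1.
  move=> /forallP mq ci ri; rewrite (bigD1 (q i)) //= !mxE.
  rewrite /sym_at /col_at /row_at permK (negPf ci) (negPf ri) !subr0 mulr1.
  rewrite big1 => [|j jqi].
    have := mq i; rewrite addr0 mem_vertices_of; move: ci ri.
    by case: (rho i) => [[r|c]|s'] //= _ _ ->.
  rewrite !mxE.
  have := mq ((q^-1)%g j); rewrite permKV mem_vertices_of.
  have ne : rho ((q^-1)%g j) != rho i.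
    rewrite (inj_eq (proj1 rhoP)); apply: contraNneq jqi => <-.
    by rewrite permKV.
  move: ci ri ne; case: (rho i) => [[r|c]|s'] //= _ _.
  case: (rho _) => [[r'|c']|s''] /= ne /eqP E; rewrite ?subr0 ?subrr ?mulr0 //.
  by rewrite mulr1 -E; case: (s' =P s'') ne => [->|]; rewrite ?eqxx ?oppr0.
pose z : 'cV[rat]_n := \col_j (col_at s j - col_at p j).
have z0 : z = 0.
  apply: (det_neq0_right dX); apply/colP=> i; rewrite !mxE.
  case ri: (is_row (rho i)).
    rewrite (bigD1 (s i)) //= !mxE ri eqxx mul1r big1 => [|j /negPf ji].
      by rewrite /col_at permK -(agree i ri) permK subrr addr0.
    by rewrite !mxE ri ji mul0r.
  transitivity (\sum_j (signed_mx i j * col_at s j - signed_mx i j * col_at p j)).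
    by apply: eq_bigr => j _; rewrite [row_matching_mx s i j]mxE ri [z _ _]mxE mulrBr.
  case ci: (is_col (rho i)); first by rewrite sumrB !colE ?subrr.
  (* As [row_at] is the same for both matchings, an excess of columns is a deficit of symbols. *)
  transitivity (\sum_j (signed_mx i j * sym_at p j - signed_mx i j * sym_at s j)).
    apply: eq_bigr => j _; rewrite -!mulrBr; congr (_ * _).
    by rewrite /sym_at /row_at row_eq opprB [RHS]addrC addrA subrK.
  by rewrite sumrB !symE ?ri ?ci ?subrr.
(* With [z = 0], both matchings give the triple [kappa (p i)] a vertex of the same kind, hence the
   same vertex. *)
apply/permP=> i.
have := vertices_of_kind (v := rho ((s^-1)%g (p i))) (w := rho i)
  (t := kappa (p i)).
have zi : is_col (rho ((s^-1)%g (p i))) = is_col (rho i).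
  have /colP/(_ (p i)) := z0; rewrite !mxE /col_at permK.
  by move/eqP; rewrite subr_eq0 eqr_nat; do 2 case: is_col.
rewrite row_eq permK zi => /(_ _ _ erefl erefl) E.
have /(proj1 rhoP) Ei : rho ((s^-1)%g (p i)) = rho i.
  apply: E; last exact: (forallP mp).
  by have := forallP ms ((s^-1)%g (p i)); rewrite permKV.
by rewrite -{2}Ei permKV.
Qed.

(** The contribution of the minus signs that [signed] puts on symbols. *)
Definition symbol_sign : rat :=
  \prod_i (if is_row (rho i) || is_col (rho i) then 1 else -1).

(** A nonzero term at [p] makes [p] a matching that agrees with [s] on the rows, so
    [matching_unique] applies. *)
Lemma det_row_matching_mx_sign s : matching s ->
  \det (row_matching_mx s) = (-1) ^+ s * symbol_sign.
Proof.
move=> ms; rewrite /determinant (bigD1 s) //= [X in _ + X]big1 ?addr0 => [|p ps].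
  congr (_ * _); apply: eq_bigr => i _; rewrite !mxE eqxx.
  have := forallP ms i; rewrite mem_vertices_of.
  by case: (rho i) => [[r|c]|s'] //= ->.
apply/eqP; rewrite mulf_eq0 signr_eq0 /=; apply/negPn/negP=> /prodf_neq0 Xp.
case/negP: ps; apply/eqP/(matching_unique ms).
  apply/forallP=> i; have := Xp i isT; rewrite !mxE.
  case ri: (is_row (rho i)).
    case: (p i =P s i) => [-> _|]; [exact: (forallP ms) | by rewrite eqxx].
  by apply: contraR => mi; rewrite signed_eq0 ?ri.
move=> i ri; have := Xp i isT; rewrite mxE ri.
by case: (p i =P s i) => // _; rewrite eqxx.
Qed.

Lemma odd_matching s p : matching s -> matching p -> odd_perm s = odd_perm p.
Proof.
move=> ms mp.
have c0 : symbol_sign != 0.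
  by apply/prodf_neq0 => i _; case: ifP.
have := etrans (det_row_matching_mx ms) (esym (det_row_matching_mx mp)).
rewrite !det_row_matching_mx_sign //.
move/(mulIf det_signed_mx)/(mulIf c0)/eqP.
by rewrite -subr_eq0; case: (odd_perm s); case: (odd_perm p).
Qed.

End Bitrade.

Theorem theorem4p6 (RT CT ST : finType) (W B : {set RT * CT * ST}) (n : nat)
    (r0 : RT) (c0 : CT) (s0 : ST)
    (rho : 'I_n -> RT + CT + ST) (kappa : 'I_n -> RT * CT * ST)
    (sphWB : spherical W B) (cardW : #|W| = n.+1)
    (t0W : (r0, c0, s0) \in W)
    (rhoP : ordering_of rho (vertices W :\: vertices_of (r0, c0, s0)))
    (kappaP : ordering_of kappa (W :\ (r0, c0, s0))) :
  (`|\det (reduced_matrix rho kappa)| = permanent (reduced_matrix rho kappa))%R.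
Proof.
case: sphWB => bit sep conn _; set M := reduced_matrix rho kappa.
have M_ge0 i j : 0 <= M i j by rewrite mxE ler0n.
have prod_ge0 s : 0 <= \prod_i M i ((s : 'S_n) i) by apply: prodr_ge0.
have prod0 s : ~~ matching rho kappa s -> \prod_i M i (s i) = 0.
  rewrite negb_forall => /existsP[i ni]; rewrite (bigD1 i) //= mxE.
  by rewrite /incidence (negPf ni) mul0r.
have [s ms|none] := pickP (matching rho kappa); last first.
  rewrite /determinant /permanent !big1 ?normr0 // => s _.
    by rewrite prod0 ?none.
  by rewrite prod0 ?none ?mulr0.
(* Every nonzero term comes from a matching, and all matchings have the sign of [s]. *)
have -> : \det M = (-1) ^+ s * permanent M.
  rewrite /permanent mulr_sumr; apply: eq_bigr => p _.
  case mp: (matching rho kappa p); last by rewrite prod0 ?mp ?mulr0.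
  by rewrite (odd_matching bit sep conn t0W rhoP kappaP ms mp).
by rewrite normrMsign ger0_norm // sumr_ge0.
Qed.
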